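(* For every integer $n\ge 0$, involutions in $\mathcal{S}_n$ are in one-to-one correspondence with the permutations in $\mathcal{S}_n$ that avoid both $(a\text{-}bc)$ and $(a\text{-}cb)$. Hence $$|\mathcal{S}_n(a\text{-}bc,\,a\text{-}cb)|=I_n,$$ where $I_n$ is the number of involutions in $\mathcal{S}_n$.
   Context: $\mathcal{S}_n$ is the set of permutations of $[n]=\{1,2,\ldots,n\}$, written as words $\pi=a_1a_2\cdots a_n$ (with $\mathcal{S}_0$ consisting of the empty word only). A (generalised) pattern is a word in distinct letters of the ordered alphabet $a<b<c<\cdots$ in which two adjacent letters may or may not be separated by a dash. A $p$-subword of $\pi$ is a subword $a_{i_1}a_{i_2}\cdots a_{i_k}$ ($i_1<i_2<\cdots<i_k$) whose letters are in the same relative order as the letters of $p$, and such that $i_{j+1}=i_j+1$ whenever the $j$th and $(j+1)$st letters of $p$ are not separated by a dash. So an $(a\text{-}bc)$-subword is a subword $a_ia_ja_{j+1}$ with $i<j$ and $a_i<a_j<a_{j+1}$, and an $(a\text{-}cb)$-subword is a subword $a_ia_ja_{j+1}$ with $i<j$ and $a_i<a_{j+1}<a_j$. A permutation avoids $p$ if it has no $p$-subword; $\mathcal{S}_n(p,q)$ is the set of permutations in $\mathcal{S}_n$ avoiding both $p$ and $q$. An involution is a permutation which is its own inverse (the identity included). *)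

(* Defs.v *)
From mathcomp Require Import all_boot all_fingroup.

Set Implicit Arguments.
Unset Strict Implicit.
Unset Printing Implicit Defensive.

(* A generalised pattern: a word in distinct letters (a, b, c, ... are coded
   as 0, 1, 2, ...) together with, for each pair of adjacent letters, a boolean
   saying whether they are separated by a dash. *)
Record gpattern := GPattern {
  pat_letters : seq nat;
  pat_dashes : seq bool;
  _ : uniq pat_letters;
  _ : size pat_dashes = (size pat_letters).-1
}.

Definition pat_length (p : gpattern) : nat := size (pat_letters p).

(* A permutation of [n] is an element s of 'S_n = {perm 'I_n}; its word is
   a_(i+1) = s i + 1 for i < n.  A subword is given by its positions t. *)
Definition p_subword (p : gpattern) (n : nat) (s : 'S_n)
    (t : (pat_length p).-tuple 'I_n) : bool :=
  [&& [forall j : 'I_(pat_length p), forall l : 'I_(pat_length p),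
        (j < l) ==> (tnth t j < tnth t l)],
      [forall j : 'I_(pat_length p), forall l : 'I_(pat_length p),
        (s (tnth t j) < s (tnth t l))
          == (nth 0 (pat_letters p) j < nth 0 (pat_letters p) l)]
    & [forall j : 'I_(pat_length p), forall l : 'I_(pat_length p),
        (l == j.+1 :> nat) && ~~ nth false (pat_dashes p) j
          ==> (tnth t l == (tnth t j).+1 :> nat)]].

Definition avoids (n : nat) (s : 'S_n) (p : gpattern) : bool :=
  ~~ [exists t, @p_subword p n s t].

Definition a_bc : gpattern :=
  @GPattern [:: 0; 1; 2] [:: true; false] isT erefl.

Definition a_cb : gpattern :=
  @GPattern [:: 0; 2; 1] [:: true; false] isT erefl.

Definition avoiders (n : nat) (p q : gpattern) : {set 'S_n} :=
  [set s | avoids s p && avoids s q].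

Definition involutions (n : nat) : {set 'S_n} := [set s | (s^-1)%g == s].

(* Main.v *)
Require Import Defs.
From mathcomp Require Import all_boot all_fingroup.
From mathcomp Require Import zify.

(** An involution is determined by its cycles, all of length 1 or 2.  Write each
    cycle with its smaller element first and list the cycles by decreasing
    minimum: erasing the parentheses gives a word in which the cycle minima are
    exactly the left-to-right minima, so the parentheses can be put back.  The
    words obtained are those without two adjacent letters that both fail to be
    left-to-right minima ([lrmin]), and this is what avoiding a-bc and a-cb
    together means ([avoidersE]): the last two letters of either pattern are
    adjacent letters above some earlier letter.

    To avoid manipulating words, the listing is described by the order
    [before t x y] in which values appear.  It is a strict total order, so it is
    the order of appearance in exactly one permutation [standard_word t]
    ([standard_wordP], [standard_word_unique]).  That map is injective on
    involutions because a non-minimal element [x] of a 2-cycle has [t x] as its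
    immediate predecessor ([before_mate], [standard_word_inj]).  Its values are
    avoiders for the same reason ([standard_word_avoids]).  Conversely, in an
    avoider each letter that is not a left-to-right minimum follows one that is,
    and exchanging the two letters of each such pair is an involution with that
    avoider as its standard word ([avoider_standard]). *)

Set Implicit Arguments.
Unset Strict Implicit.
Unset Printing Implicit Defensive.

Section StandardWord.

Local Open Scope group_scope.

Variable n : nat.
Implicit Types (s t : 'S_n) (i j k x y z : 'I_n).

(** * Avoidance in terms of left-to-right minima *)

Definition lrmin s j := [forall i : 'I_n, (i < j) ==> (s j < s i)].

Lemma lrminP s j : reflect (forall i, i < j -> s j < s i) (lrmin s j).
Proof. by apply: (iffP forallP) => H i; move/implyP: (H i). Qed.

Lemma perm_ltNge s i j : i != j -> (s i < s j) = ~~ (s j < s i).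
Proof.
move=> ij; have: s i != s j by rewrite (inj_eq perm_inj).
by rewrite -val_eqE /=; lia.
Qed.

Lemma lrminPn s j : reflect (exists2 i : 'I_n, i < j & s i < s j) (~~ lrmin s j).
Proof.
apply: (iffP idP) => [|[i ij sij]]; last first.
  by apply/negP => /lrminP/(_ i ij); lia.
move/forallPn => [i]; rewrite negb_imply => /andP[ij sji]; exists i => //.
by rewrite perm_ltNge // -val_eqE /= ltn_eqF.
Qed.

Lemma avoids_a_bcP s :
  reflect (forall i j k, i < j -> k = j.+1 :> nat -> s i < s j -> ~~ (s j < s k))
          (avoids s a_bc).
Proof.
apply: (iffP existsPn) => [H i j k ij jk sij | H t].
  apply/negP => sjk; move/negP: (H [tuple i; j; k]); apply.
  apply/and3P; split; apply/forallP => -[[|[|[|a]]] Ha] //=;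
    apply/forallP => -[[|[|[|b]]] Hb] //=; rewrite !(tnth_nth i) /=; lia.
apply/negP => /and3P[/forallP Hlt /forallP Hord /forallP Hadj].
pose o0 : 'I_3 := @Ordinal 3 0 isT.
pose o1 : 'I_3 := @Ordinal 3 1 isT.
pose o2 : 'I_3 := @Ordinal 3 2 isT.
have /negP := H (tnth t o0) (tnth t o1) (tnth t o2)
  (implyP (forallP (Hlt o0) o1) isT)
  (eqP (implyP (forallP (Hadj o1) o2) isT))
  (etrans (eqP (forallP (Hord o0) o1)) erefl).
by apply; rewrite (eqP (forallP (Hord o1) o2)).
Qed.

Lemma avoids_a_cbP s :
  reflect (forall i j k, i < j -> k = j.+1 :> nat -> s i < s k -> ~~ (s k < s j))
          (avoids s a_cb).
Proof.
apply: (iffP existsPn) => [H i j k ij jk sik | H t].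
  apply/negP => skj; move/negP: (H [tuple i; j; k]); apply.
  apply/and3P; split; apply/forallP => -[[|[|[|a]]] Ha] //=;
    apply/forallP => -[[|[|[|b]]] Hb] //=; rewrite !(tnth_nth i) /=; lia.
apply/negP => /and3P[/forallP Hlt /forallP Hord /forallP Hadj].
pose o0 : 'I_3 := @Ordinal 3 0 isT.
pose o1 : 'I_3 := @Ordinal 3 1 isT.
pose o2 : 'I_3 := @Ordinal 3 2 isT.
have /negP := H (tnth t o0) (tnth t o1) (tnth t o2)
  (implyP (forallP (Hlt o0) o1) isT)
  (eqP (implyP (forallP (Hadj o1) o2) isT))
  (etrans (eqP (forallP (Hord o0) o2)) erefl).
by apply; rewrite (eqP (forallP (Hord o2) o1)).
Qed.

(** Suppose that neither [s j] nor [s k] is a left-to-right minimum, and take the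
    earlier letter witnessing this for the smaller of the two.  It stands before
    position [j], because [s j] itself is no witness when [s k < s j], so it
    forms one of the two patterns with [s j] and [s k].  Conversely the first
    letter of a pattern witnesses that neither of the last two letters is a
    left-to-right minimum. *)
Lemma avoidersE s :
  reflect (forall j k, k = j.+1 :> nat -> lrmin s j || lrmin s k)
          (s \in avoiders n a_bc a_cb).
Proof.
rewrite inE; apply: (iffP andP) => [[/avoids_a_bcP bc /avoids_a_cbP cb] j k jk | H].
  apply/norP => -[/lrminPn[i ij sij] /lrminPn[i' i'k si'k]].
  have jNk : k != j by rewrite -val_eqE /=; lia.
  have skj : s k < s j by rewrite perm_ltNge // (bc _ _ _ ij jk sij).
  have i'j : i' < j.
    have: i' != j by apply/eqP => E; move: si'k; rewrite E; lia.
    by rewrite -val_eqE /=; lia.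
  by have:= cb _ _ _ i'j jk si'k; rewrite skj.
split; [apply/avoids_a_bcP | apply/avoids_a_cbP] => i j k ij jk si; apply/negP => sk;
  (have ik : i < k by lia);
  by have /orP[/lrminP/(_ _ ij)|/lrminP/(_ _ ik)] := H _ _ jk; lia.
Qed.

(** * The order in which the cycles are listed *)

Definition cycmin t x := minn x (t x).

Definition before t x y :=
  (cycmin t y < cycmin t x) || (cycmin t x == cycmin t y) && (x < y).

Lemma before_irr t x : before t x x = false.
Proof. by rewrite /before; lia. Qed.

Lemma before_trans t x y z : before t x y -> before t y z -> before t x z.
Proof. by rewrite /before; lia. Qed.

Lemma before_total t x y : x != y -> before t x y || before t y x.
Proof. by rewrite /before -val_eqE /=; lia. Qed.

Lemma before_asym t x y : before t x y -> before t y x = false.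
Proof. by rewrite /before; lia. Qed.

Definition before_rank t x := #|[set y | before t y x]|.

Lemma before_rank_mono t x y : before t x y -> before_rank t x < before_rank t y.
Proof.
move=> xy; apply/proper_card/properP; split.
  by apply/subsetP => z; rewrite !inE => zx; apply: before_trans zx xy.
by exists x; rewrite inE ?before_irr.
Qed.

Lemma before_rank_lt t x : before_rank t x < n.
Proof.
rewrite -[n in _ < n]card_ord -cardsT; apply/proper_card/properP; split=> //.
by exists x; rewrite !inE ?before_irr.
Qed.

Definition position t x : 'I_n := Ordinal (before_rank_lt t x).

Lemma position_inj t : injective (position t).
Proof.
move=> x y /(congr1 val) /= E; apply/eqP/negPn/negP => /(before_total t).
by case/orP => /before_rank_mono; rewrite E ltnn.
Qed.

Definition standard_word t : 'S_n := (perm (@position_inj t))^-1.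

Lemma standard_wordP t i j :
  (i < j) = before t (standard_word t i) (standard_word t j).
Proof.
have pos k : k = before_rank t (standard_word t k) :> nat.
  by rewrite -[LHS](congr1 val (permKV (perm (@position_inj t)) k)) permE.
rewrite [in LHS](pos i) [in LHS](pos j).
apply/idP/idP; last exact: before_rank_mono.
apply: contraTT => Nij; rewrite -leqNgt.
have [-> //|ij] := eqVneq (standard_word t i) (standard_word t j).
by have:= before_total t ij; rewrite (negPf Nij) => /before_rank_mono/ltnW.
Qed.

Lemma card_ord_ltn i : #|[set k : 'I_n | k < i]| = i.
Proof.
by rewrite -sum1dep_card -(big_ord_widen n (fun=> 1%N)) 1?ltnW // sum1_card card_ord.
Qed.

(** Both sides put the value [s i] at the position counting the values listed
    before it. *)
Lemma standard_word_unique s t :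
  (forall i j, i < j -> before t (s i) (s j)) -> s = standard_word t.
Proof.
move=> H; apply/permP => i; apply: (canRL (permK _)); rewrite permE.
apply: val_inj; rewrite /= /before_rank -[RHS]card_ord_ltn.
rewrite -(card_preimset [set y | before t y (s i)] (@perm_inj _ s)).
apply: eq_card => k; rewrite !inE.
apply/idP/idP => [|/H//]; apply: contraLR; rewrite -leqNgt leq_eqVlt.
case/predU1P => [/val_inj ->|/H/before_asym->//]; by rewrite before_irr.
Qed.

(** * From involutions to avoiders *)

Lemma involutionsP t : reflect (involutive t) (t \in involutions n).
Proof.
rewrite inE; apply: (iffP eqP) => [E x | H]; first by rewrite -{1}E permK.
by apply/permP => x; apply: (canLR (permK _)); rewrite H.
Qed.

(** The mate [t x] comes immediately before [x]: no third value shares their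
    cycle minimum, so any other value is compared alike with both. *)
Lemma before_mate t x y : involutive t -> t x < x ->
  before t y x = (y == t x) || before t y (t x).
Proof.
move=> tK txx; have [->|ytx] /= := eqVneq y (t x).
  by rewrite /before /cycmin tK; lia.
have: (t y == x) = false by rewrite (canF_eq tK); apply/negbTE.
have: (t y == t x) = (y == x) by rewrite (inj_eq perm_inj).
by move: ytx; rewrite /before /cycmin tK -!val_eqE /=; lia.
Qed.

(** Both word orders agree, so by [before_mate] both [t x] and [t' x] are the
    value just before [x], provided [x] is not a cycle minimum of [t'] either;
    this holds since the smaller value [t x] is listed before [x]. *)
Lemma before_determines_mate t t' x :
  involutive t -> involutive t' -> before t =2 before t' ->
  t x < x -> t' x = t x.
Proof.
move=> tK t'K E txx.
have txb : before t' (t x) x by rewrite -E before_mate // eqxx.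
have t'xx : t' x < x by move: txb; rewrite /before /cycmin; lia.
apply/eqP; move: (txb); rewrite before_mate // eq_sym => /orP[//|tt'].
have: before t (t' x) x by rewrite E before_mate // eqxx.
by rewrite before_mate // => /orP[//|]; rewrite E (before_asym tt').
Qed.

Lemma standard_word_inj : {in involutions n &, injective standard_word}.
Proof.
move=> t t' /involutionsP tK /involutionsP t'K E.
have bE : before t =2 before t'.
  move=> x y; pose u := standard_word t.
  rewrite -[x](permKV u) -[y](permKV u) -standard_wordP {}/u E.
  by rewrite -standard_wordP.
have mateE := before_determines_mate tK t'K bE.
have mateE' := before_determines_mate t'K tK (fun x y => esym (bE x y)).
apply/permP => x.
have [/mateE//|] := ltnP (t x) x; rewrite leq_eqVlt.
case/orP => [xE|xt]; last by have:= mateE (t x); rewrite tK => /(_ xt) {2}<-.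
have [/mateE'//|] := ltnP (t' x) x; rewrite leq_eqVlt.
case/orP => [xE'|xt']; last by have:= mateE' (t' x); rewrite t'K => /(_ xt') {1}<-.
by apply: val_inj; rewrite /= -(eqP xE) -(eqP xE').
Qed.

Lemma cycmin_lrmin t j :
  standard_word t j <= t (standard_word t j) -> lrmin (standard_word t) j.
Proof.
set s := standard_word t => jmin; apply/lrminP => i ij.
have: s i != s j by rewrite (inj_eq perm_inj) -val_eqE /= ltn_eqF.
by move: ij; rewrite (standard_wordP t) -/s /before /cycmin -val_eqE /=; lia.
Qed.

(** If [s k] is not a cycle minimum, the letter [s j] just before it is its mate,
    hence a cycle minimum. *)
Lemma standard_word_avoids t :
  t \in involutions n -> standard_word t \in avoiders n a_bc a_cb.
Proof.
move/involutionsP => tK; apply/avoidersE => j k jk; apply/orP.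
set s := standard_word t.
have [kmin|tk] := leqP (s k) (t (s k)); [by right; apply: cycmin_lrmin | left].
apply: cycmin_lrmin; rewrite -/s.
have: before t (s j) (s k) by rewrite -standard_wordP jk.
rewrite before_mate // => /orP[/eqP->|]; first by rewrite tK ltnW.
rewrite -[t (s k)](permKV s) -standard_wordP => jm.
have: before t (t (s k)) (s k) by rewrite before_mate // eqxx.
by rewrite -{1}[t (s k)](permKV s) -standard_wordP; lia.
Qed.

(** * From avoiders to involutions *)

(** The cyclic successor needs no guard at the last position, because it is then
    the first one, which is always a left-to-right minimum. *)
Definition mate_pos s j :=
  if ~~ lrmin s j then ord_pred j else
  if ~~ lrmin s (ordS j) then ordS j else j.

Lemma ord_pred_nonmin s j : ~~ lrmin s j -> j = (ord_pred j).+1 :> nat.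
Proof.
case/lrminPn => i ij _ /=; have jn := ltn_ord j.
have -> : (j + n).-1 = j.-1 + n by lia.
by rewrite modnDr modn_small; lia.
Qed.

Section Avoider.

Variable s : 'S_n.
Hypothesis sA : s \in avoiders n a_bc a_cb.

Lemma lrmin_ord_pred j : ~~ lrmin s j -> lrmin s (ord_pred j).
Proof.
move=> Nj; have /orP[//|] := avoidersE _ sA _ _ (ord_pred_nonmin Nj).
by rewrite (negPf Nj).
Qed.

Lemma lt_ord_pred j : ~~ lrmin s j -> s (ord_pred j) < s j.
Proof.
move=> Nj; have jE := ord_pred_nonmin Nj.
have /lrminPn[i ij sij] := Nj.
have: i <= ord_pred j by lia.
rewrite leq_eqVlt => /predU1P[/val_inj<-//|ip].
by have:= lrminP _ _ (lrmin_ord_pred Nj) _ ip; lia.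
Qed.

Lemma mate_posK : involutive (mate_pos s).
Proof.
move=> j; rewrite /mate_pos; case: (boolP (lrmin s j)) => Hj /=.
  by case: (boolP (lrmin s (ordS j))) => HS /=; rewrite ?Hj HS //= ordSK.
by rewrite lrmin_ord_pred //= ord_predK Hj.
Qed.

Definition block_head j := if lrmin s j then j else ord_pred j.

Lemma min_mate_pos j : minn (s j) (s (mate_pos s j)) = s (block_head j).
Proof.
rewrite /mate_pos /block_head; case: (boolP (lrmin s j)) => Hj /=.
  case: (boolP (lrmin s (ordS j))) => HS /=; first by rewrite minnn.
  by have:= lt_ord_pred HS; rewrite ordSK; lia.
by have:= lt_ord_pred Hj; lia.
Qed.

Lemma lrmin_block_head j : lrmin s (block_head j).
Proof. by rewrite /block_head; case: ifPn => // /lrmin_ord_pred. Qed.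

Definition block_swap : 'S_n := s^-1 * perm (can_inj mate_posK) * s.

Lemma block_swapE j : block_swap (s j) = s (mate_pos s j).
Proof. by rewrite !permM permK permE. Qed.

Lemma block_swap_involution : block_swap \in involutions n.
Proof.
by apply/involutionsP => x; rewrite -[x](permKV s) !block_swapE mate_posK.
Qed.

(** For [i < j] the heads of the blocks of [i] and [j] are in weakly increasing
    positions.  If they differ, the later one carries the smaller letter, being a
    left-to-right minimum; if not, [j] is the second position of the block of
    [i] and carries the larger letter. *)
Lemma block_swap_standard : s = standard_word block_swap.
Proof.
apply: standard_word_unique => i j ij.
rewrite /before /cycmin !block_swapE !min_mate_pos.
have hi : block_head i <= i.
  by rewrite /block_head; case: ifPn => // /ord_pred_nonmin; lia.
have hj : i <= block_head j.
  by rewrite /block_head; case: ifPn => [_|/ord_pred_nonmin]; lia.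
have := leq_trans hi hj; rewrite leq_eqVlt => /predU1P[E|]; last first.
  by move/(lrminP _ _ (lrmin_block_head j)) => ->.
have iE : i = block_head j by apply: val_inj => /=; lia.
apply/orP; right; rewrite (val_inj E) eqxx /=.
move: iE ij; rewrite /block_head; case: ifPn => [_ ->|Nj -> _]; first by rewrite ltnn.
exact: lt_ord_pred.
Qed.

End Avoider.

Lemma avoider_standard s : s \in avoiders n a_bc a_cb ->
  exists2 t, t \in involutions n & s = standard_word t.
Proof.
move=> sA; exists (block_swap sA); first exact: block_swap_involution.
exact: block_swap_standard.
Qed.

Lemma standard_word_image :
  standard_word @: involutions n = avoiders n a_bc a_cb.
Proof.
apply/setP => s; apply/imsetP/idP => [[t tI ->]|]; first exact: standard_word_avoids.
exact: avoider_standard.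
Qed.

End StandardWord.

Theorem proposition8 (n : nat) :
  (exists f : {s : 'S_n | s \in involutions n} ->
              {s : 'S_n | s \in avoiders n a_bc a_cb}, bijective f)
  /\ #|avoiders n a_bc a_cb| = #|involutions n|.
Proof.
have cardE : #|avoiders n a_bc a_cb| = #|involutions n|.
  by rewrite -standard_word_image card_in_imset //; apply: standard_word_inj.
split=> //.
exists (fun t => exist _ (standard_word (val t)) (standard_word_avoids (valP t))).
apply: inj_card_bij => [t t' /(congr1 val) /= E|].
  by apply/val_inj/standard_word_inj => //; apply: valP.
by rewrite !card_sig cardE.
Qed.
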